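(* Let $V_{\min}$ and $V_{\max}$ be constants such that $0 < V_{\min} \le V_{\max} < \infty$. For an arbitrary sequence of nested sets $\mathscr{B}_i$, $i = 1, \dots, m$, such that $\mathscr{B}_1 \subset \mathscr{B}_2 \subset \cdots \subset \mathscr{B}_m$ and $V_{\min} \le \mathrm{vol}(\mathscr{B}_1) \le \mathrm{vol}(\mathscr{B}_m) \le V_{\max}$, let $\boldsymbol{n} = \sum_{i=1}^m \mathbf{n}_i$ be the total number of experiments performed under the sample reuse procedure to obtain $N$ experiments for each of the sets $\mathscr{B}_1,\dots,\mathscr{B}_m$. Then the expected total number of experiments is absolutely bounded, independently of the number $m$ of sets in the chain: $$\mathbb{E}[\boldsymbol{n}] < \left(1 + \ln\frac{V_{\max}}{V_{\min}}\right) N .$$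
   Context: The sets $\mathscr{B}_i$ are Lebesgue measurable subsets of a fixed Euclidean space, $\mathrm{vol}$ denotes Lebesgue measure, $N \ge 1$ is an integer, and $\mathbb{E}$ denotes expectation. Sample reuse procedure: one needs $N$ experiments for each set, an experiment for a set being based on a sample drawn uniformly and independently from it. The sets are processed from the largest to the smallest. Formally, let $\{U_j^\ell : 1\le j\le m,\ 1\le \ell\le N\}$ be mutually independent random variables with $U_j^\ell$ uniformly distributed on $\mathscr{B}_j$. Set $\mathbf{n}_m = N$; the samples generated from $\mathscr{B}_m$ are $U_m^1,\dots,U_m^N$. Recursively for $j = m-1, m-2, \dots, 1$, all the samples previously generated from the larger sets $\mathscr{B}_k$, $k>j$, that fall in $\mathscr{B}_j$ are reused for $\mathscr{B}_j$, and only the missing ones are newly generated: with $X_{k,j}^\ell = 1$ if $U_k^\ell\in\mathscr{B}_j$ and $X_{k,j}^\ell=0$ otherwise, $$\mathbf{n}_j = N - \sum_{k=j+1}^m \sum_{\ell=1}^{\mathbf{n}_k} X_{k,j}^\ell ,$$ and the samples newly generated from $\mathscr{B}_j$ are $U_j^1,\dots,U_j^{\mathbf{n}_j}$. Because the sets are nested, $0\le\mathbf{n}_j\le N$ always. The random variable $\mathbf{n}_j$ is the actual number of experiments performed for $\mathscr{B}_j$.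
   Formalization: When V_min = V_max the strict inequality is false (all sets have equal volume and E[n] = N equals the bound), so the formal statement proves E[n] ≤ (1 + ln(V_max/V_min))N in general and the strict inequality whenever V_min < V_max. *)

(* Defs.v *)
From HB Require Import structures.
From mathcomp Require Import all_boot all_order all_algebra finmap.
From mathcomp Require Import all_classical all_reals all_analysis.

Set Implicit Arguments.
Unset Strict Implicit.
Unset Printing Implicit Defensive.
Import Order.TTheory GRing.Theory Num.Theory.
Import numFieldNormedType.Exports.

Local Open Scope classical_set_scope.
Local Open Scope ring_scope.

Definition box (R : realType) (n : nat) (c : 'rV[R]_n * 'rV[R]_n) :
    set 'rV[R]_n :=
  [set x | forall i, c.1 0 i < x 0 i <= c.2 0 i].

Definition box_vol (R : realType) (n : nat) (c : 'rV[R]_n * 'rV[R]_n) : \bar R :=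
  (\prod_(i < n) Num.max 0 (c.2 0 i - c.1 0 i))%:E.

Definition box_cover (R : realType) (n : nat) (A : set 'rV[R]_n) :
    set (nat -> 'rV[R]_n * 'rV[R]_n) :=
  [set c | A `<=` \bigcup_k box (c k)].

(* The dimension is a successor because in dimension 0 every box is the whole
   one-point space, and the empty set would get outer measure +oo. *)
Definition lebesgue_outer (R : realType) (d : nat) (A : set 'rV[R]_d.+1) :
    \bar R :=
  ereal_inf [set (\sum_(k <oo) box_vol (c k))%E | c in box_cover A].

Lemma box_vol_ge0 (R : realType) (n : nat) (c : 'rV[R]_n * 'rV[R]_n) :
  (0 <= box_vol c)%E.
Proof. by rewrite lee_fin; apply: prodr_ge0 => i _; rewrite le_max lexx. Qed.

Lemma lebesgue_outer_ge0 (R : realType) (d : nat) (A : set 'rV[R]_d.+1) :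
  (0 <= lebesgue_outer A)%E.
Proof.
apply: le_ereal_inf_tmp => _ [c _ <-].
by apply: nneseries_ge0 => k _ _; exact: box_vol_ge0.
Qed.

Lemma lebesgue_outer0 (R : realType) (d : nat) :
  lebesgue_outer (set0 : set 'rV[R]_d.+1) = 0%E.
Proof.
apply/eqP; rewrite eq_le lebesgue_outer_ge0 andbT.
apply: ereal_inf_lbound; exists (fun=> (0, 0)); first exact: sub0set.
apply: eseries0 => k _ _.
by rewrite /box_vol big_ord_recl /= subrr maxxx mul0r.
Qed.

Lemma le_lebesgue_outer (R : realType) (d : nat) :
  {homo @lebesgue_outer R d : A B / A `<=` B >-> (A <= B)%E}.
Proof.
move=> A B AB; apply/ereal_inf_le_tmp => _ [c Bc <-].
by exists c => //; exact: subset_trans AB Bc.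
Qed.

Lemma lebesgue_outer_sigma_subadditive (R : realType) (d : nat) :
  sigma_subadditive (@lebesgue_outer R d).
Proof.
move=> A; have [[i ioo]|] := pselect (exists i, lebesgue_outer (A i) = +oo%E).
  rewrite (eseries_pinfty _ _ ioo) ?leey// => n _.
  by rewrite -ltNye (lt_le_trans _ (lebesgue_outer_ge0 _)).
rewrite -forallNE => Aoo.
suff add2e (e : {posnum R}) : (lebesgue_outer (\bigcup_n A n) <=
    \sum_(i <oo) lebesgue_outer (A i) + e%:num%:E)%E.
  by apply/lee_addgt0Pr => _/posnumP[].
rewrite (le_trans _ (epsilon_trick _ _ _))//; last first.
  by move=> n; exact: lebesgue_outer_ge0.
pose P n (c : nat -> 'rV[R]_d.+1 * 'rV[R]_d.+1) := box_cover (A n) c /\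
  (\sum_(k <oo) box_vol (c k) <=
     lebesgue_outer (A n) + (e%:num / (2 ^ n.+1)%:R)%:E)%E.
have [G PG] : {G : nat -> nat -> 'rV[R]_d.+1 * 'rV[R]_d.+1 &
    forall n, P n (G n)}.
  apply: (@choice _ _ P) => n; rewrite /P.
  have fA : lebesgue_outer (A n) \is a fin_num.
    by rewrite ge0_fin_numE ?lebesgue_outer_ge0// ltey; apply/eqP.
  have en1 : 0 < e%:num / (2 ^ n.+1)%:R :> R by [].
  have [_ [c Ac <-] lec] := lb_ereal_inf_adherent en1 fA.
  by exists c; split => //; exact/ltW.
have volG_ge0 x : (0 <= (@box_vol R d.+1 \o uncurry G) x)%E.
  exact: box_vol_ge0.
apply: (@le_trans _ _ (\esum_(i in setT) (@box_vol R d.+1 \o uncurry G) i)%E).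
  apply: ereal_inf_lbound => /=.
  have /card_esym/ppcard_eqP[f] := card_nat2.
  exists (uncurry G \o f).
    move=> t [i _ /(PG i).1[j _ Gijt]]; exists (f^-1%FUN (i, j)) => //=.
    by rewrite invK ?inE.
  rewrite -(esum_pred_image (@box_vol R d.+1 \o uncurry G) _ xpredT)
    ?[fun=> _]set_true//.
  by rewrite image_eq.
rewrite (_ : esum _ _ = \sum_(i <oo) \sum_(j <oo) box_vol (G i j))%E; last first.
  pose J : nat -> set (nat * nat) := fun i => [set (i, j) | j in setT].
  rewrite (_ : setT = \bigcup_k J k); last first.
    by rewrite predeqE => -[a b]; split => // _; exists a => //; exists b.
  rewrite esum_bigcupT /=; last 2 first.
    - apply/trivIsetP => i j _ _ ij.
      rewrite predeqE => -[n m] /=; split => //= -[] [_] _ [<-{n} _].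
      by move=> [m' _] [] /esym/eqP; rewrite (negbTE ij).
    - by move=> /= [n m]; exact: box_vol_ge0.
  rewrite -(image_id [set: nat]) -fun_true esum_pred_image//; last first.
    by move=> n _; apply: esum_ge0 => -[a b] _; exact: box_vol_ge0.
  apply: eq_eseriesr => /= j _.
  rewrite -(esum_pred_image (@box_vol R d.+1 \o uncurry G) (pair j) predT)//=; last 2 first.
    - by move=> n _; exact: box_vol_ge0.
    - by move=> ? ? _ _; exact: (@can_inj _ _ _ snd).
  by congr esum; rewrite predeqE => -[a b]; split; move=> [i _ <-]; exists i.
apply: lee_nneseries => [n _ _|n _]; last exact: (PG n).2.
by apply: nneseries_ge0 => k _ _; exact: box_vol_ge0.
Qed.

HB.instance Definition _ (R : realType) (d : nat) :=
  isOuterMeasure.Build R 'rV[R]_d.+1 (@lebesgue_outer R d)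
    (@lebesgue_outer0 R d) (@lebesgue_outer_ge0 R d) (@le_lebesgue_outer R d)
    (@lebesgue_outer_sigma_subadditive R d).

(* R^(d+1) with the sigma-algebra of Lebesgue (not merely Borel) measurable
   sets. *)
Definition euclid (R : realType) (d : nat) :=
  caratheodory_type (@lebesgue_outer R d).

HB.instance Definition _ (R : realType) (d : nat) :=
  Measurable.on (euclid R d).

Definition vol (R : realType) (d : nat) : set (euclid R d) -> \bar R :=
  @lebesgue_outer R d.

HB.instance Definition _ (R : realType) (d : nat) :=
  isMeasure.Build _ (euclid R d) R (@vol R d)
    (caratheodory_measure0 (@lebesgue_outer R d))
    (caratheodory_measure_ge0 (mu := @lebesgue_outer R d))
    (caratheodory_measure_sigma_additive (mu := @lebesgue_outer R d)).

Definition uniform_on (disp : measure_display) (Omega : measurableType disp)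
    (R : realType) (P : probability Omega R) (d : nat) (B : set (euclid R d))
    (X : {RV P >-> euclid R d}) : Prop :=
  forall A : set (euclid R d), measurable A ->
    distribution P X A = (vol (A `&` B) / vol B)%E.

Definition mutually_independent (disp disp' : measure_display)
    (Omega : measurableType disp) (T : measurableType disp') (R : realType)
    (P : probability Omega R) (I : choiceType) (D : set I)
    (X : I -> {RV P >-> T}) : Prop :=
  forall (J : {fset I}) (A : I -> set T), [set` J] `<=` D ->
    (forall i, i \in J -> measurable (A i)) ->
    P (\bigcap_(i in [set` J]) X i @^-1` A i) =
      (\prod_(i <- J) P (X i @^-1` A i))%E.

(* Indices start at 1. [u j l] is the value of the [l]-th candidate sample for
   [B j]. The first argument is fuel for the recursion, which descends from [m];
   any amount exceeding [m - j] gives the same value. *)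
Fixpoint num_new_rec (T : Type) (B : nat -> set T) (N m : nat)
    (u : nat -> nat -> T) (fuel j : nat) : nat :=
  if fuel is fuel'.+1 then
    (N - \sum_(j.+1 <= k < m.+1)
           \sum_(1 <= l < (num_new_rec B N m u fuel' k).+1) (u k l \in B j))%N
  else 0.

(* The subtraction is never truncated for nested sets, see [num_reused_le]. *)
Definition num_new (T : Type) (B : nat -> set T) (N m : nat)
    (u : nat -> nat -> T) (j : nat) : nat :=
  num_new_rec B N m u (m - j).+1 j.

Definition num_reused (T : Type) (B : nat -> set T) (N m : nat)
    (u : nat -> nat -> T) (j : nat) : nat :=
  (\sum_(j.+1 <= k < m.+1)
     \sum_(1 <= l < (num_new B N m u k).+1) (u k l \in B j))%N.

Lemma num_newE (T : Type) (B : nat -> set T) (N m : nat)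
    (u : nat -> nat -> T) (j : nat) :
  num_new B N m u j = (N - num_reused B N m u j)%N.
Proof.
have fuelE r s k : (m - k < r)%N -> (m - k < s)%N ->
    num_new_rec B N m u r k = num_new_rec B N m u s k.
  elim: r s k => [|r IH] [|s] k //= rk sk; congr (_ - _)%N.
  apply: eq_big_nat => i /andP[ki im]; rewrite (IH s)//.
    by rewrite -ltnS (leq_trans _ rk)// !ltnS ltn_sub2l// (leq_trans ki).
  by rewrite -ltnS (leq_trans _ sk)// !ltnS ltn_sub2l// (leq_trans ki).
rewrite /num_new /=; congr (_ - _)%N.
apply: eq_big_nat => k /andP[jk km]; rewrite (fuelE _ (m - k).+1)//.
by rewrite ltn_sub2l// (leq_trans jk).
Qed.

Lemma num_reused_le (T : Type) (B : nat -> set T) (N m : nat)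
    (u : nat -> nat -> T) (j : nat) :
  (forall i, (0 < i < m)%N -> B i `<=` B i.+1) -> (0 < j <= m)%N ->
  (num_reused B N m u j <= N)%N.
Proof.
move=> Bn /andP[j0 jm].
have [r rE] : exists r, (m - j)%N = r by exists (m - j)%N.
elim: r j j0 jm rE => [|r IH] j j0 jm rE.
  rewrite /num_reused big_geq// ltnS -subn_eq0; exact/eqP.
have ltjm : (j < m)%N by rewrite -subn_gt0 rE.
have {}IH : (num_reused B N m u j.+1 <= N)%N.
  by apply: IH => //; rewrite subnS rE.
rewrite /num_reused big_ltn ?ltnS//.
rewrite -[leqRHS](subnK IH) -num_newE leq_add//.
  apply: (@leq_trans (\sum_(1 <= l < (num_new B N m u j.+1).+1) 1)%N).
    by apply: leq_sum => l _; exact: leq_b1.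
  by rewrite sum_nat_const_nat subSS subn0 muln1.
apply: leq_sum => k _; apply: leq_sum => l _.
case: (boolP (u k l \in B j)) => // /[!inE] /(Bn j _) uB.
by rewrite mem_set//; apply: uB; rewrite j0 ltjm.
Qed.

Definition num_total (T : Type) (B : nat -> set T) (N m : nat)
    (u : nat -> nat -> T) : nat :=
  (\sum_(1 <= j < m.+1) num_new B N m u j)%N.

(* Main.v *)
(** With v_j the volume of B_j, every stage has exactly N experiments, so
    N = n_j + (number of reused samples). Whether the l-th candidate of stage
    k > j is used at all, i.e. l <= n_k, depends only on the candidates of the
    stages after k, hence is independent of the event that this candidate falls
    in B_j, of probability v_j / v_k. Taking expectations,
    N / v_j = \sum_(k >= j) E[n_k] / v_k, so that E[n_m] = N and
    E[n_j] = N (1 - v_j / v_{j+1}) for j < m. Since 1 - x <= - ln x, strictly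
    unless x = 1, the sum of these telescopes to the logarithmic bound. *)

Require Import Defs.
From mathcomp Require Import all_boot all_order all_algebra finmap ring lra.
From mathcomp Require Import all_classical all_reals all_analysis measurable_realfun.
Import Order.TTheory GRing.Theory Num.Theory.

Local Open Scope classical_set_scope.
Local Open Scope ring_scope.

(** * Measurability of functions with values in [nat] *)

Lemma measurable_fun_nat2 {disp} {T : measurableType disp} (g : nat -> nat -> nat)
    (f1 f2 : T -> nat) :
  measurable_fun [set: T] f1 -> measurable_fun [set: T] f2 ->
  measurable_fun [set: T] (fun w => g (f1 w) (f2 w)).
Proof.
move=> mf1 mf2 _ Y _; rewrite setTI.
(* As [nat] is countable and discrete, the preimage splits over the countably many pairs of values
   of [f1] and [f2]. *)
have -> : (fun w => g (f1 w) (f2 w)) @^-1` Y =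
    \bigcup_a \bigcup_(b in [set b | Y (g a b)])
      (f1 @^-1` [set a] `&` f2 @^-1` [set b]).
  apply/seteqP; split=> [w Yw|w [a _ [b Yab [/= -> ->]]]]; last exact: Yab.
  by exists (f1 w) => //; exists (f2 w).
apply: bigcup_measurable => a _; apply: bigcup_measurable => b _.
by apply: measurableI; rewrite -[X in measurable X]setTI; [exact: mf1|exact: mf2].
Qed.

Lemma measurable_fun_sumn {disp} {T : measurableType disp} {I : eqType} (r : seq I)
    (f : I -> T -> nat) :
  (forall i, i \in r -> measurable_fun [set: T] (f i)) ->
  measurable_fun [set: T] (fun w => \sum_(i <- r) f i w)%N.
Proof.
elim: r => [|i r IH] mf.
  rewrite (_ : (fun=> _) = cst 0%N)//.
  by apply/funext => w; rewrite big_nil.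
rewrite (_ : (fun=> _) = fun w => f i w + \sum_(j <- r) f j w)%N; last first.
  by apply/funext => w; rewrite big_cons.
apply: (measurable_fun_nat2 addn); first exact/mf/mem_head.
by apply: IH => j jr; apply: mf; rewrite in_cons jr orbT.
Qed.

(** * Independence of one variable from the sigma-algebra generated by others *)

Section independence.
Context {disp disp' : measure_display} {Omega : measurableType disp}
  {T : measurableType disp'} {R : realType} {P : probability Omega R}
  {I : choiceType}.
Implicit Types (X : I -> {RV P >-> T}) (S D : set I).

(** A pi-system generating the sigma-algebra of the variables [X i], [i] in [S]. On its members,
    mutual independence is directly a product formula. *)
Definition cylinders (X : I -> {RV P >-> T}) (S : set I) : set (set Omega) :=
  [set E | exists (J : {fset I}) (A : I -> set T),
    [/\ [set` J] `<=` S, forall i, measurable (A i) &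
        E = \bigcap_(i in [set` J]) X i @^-1` A i] ].

Lemma measurable_cylinders X S : cylinders X S `<=` measurable.
Proof.
move=> _ [J [A [_ mA ->]]]; apply: fin_bigcap_measurable => // i _.
by rewrite -[X in measurable X]setTI; exact: measurable_funPT.
Qed.

Lemma setI_closed_cylinders X S : setI_closed (cylinders X S).
Proof.
move=> _ _ [J [A [JS mA ->]]] [K [C [KS mC ->]]].
(* An index missing from one of the two finite sets gets the trivial constraint [setT] there. *)
exists (J `|` K)%fset, (fun i => (if i \in J then A i else setT) `&`
  (if i \in K then C i else setT)); split.
- by move=> i /=; rewrite in_fsetU => /orP[/JS|/KS].
- by move=> i; apply: measurableI; case: ifP.
apply/seteqP; split=> [w [wA wC] i /=|w wAC].
  split; first by case: ifP => // /wA.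
  by case: ifP => // /wC.
split=> i /= iJ; have := wAC i; rewrite /= in_fsetU iJ ?orbT.
  by case=> //; rewrite iJ.
by case=> //; rewrite iJ.
Qed.

(* In [E] both sides are finite measures, and they agree on the pi-system of
   cylinders. *)
Lemma mutually_independent_sigma D X S i A E :
  mutually_independent D X -> S `<=` D -> D i -> ~ S i -> measurable A ->
  <<s cylinders X S >> E -> P (E `&` X i @^-1` A) = (P E * P (X i @^-1` A))%E.
Proof.
move=> indep SD Di Si mA sE.
have mXA : measurable (X i @^-1` A).
  by rewrite -[X in measurable X]setTI; exact: measurable_funPT.
(* The probability of the fixed event becomes a nonnegative real scalar, so that the right-hand side
   is the measure [mscale r P]; the left-hand side is the restriction [mrestr P mXA]. *)
have p_ge0 : 0 <= fine (P (X i @^-1` A)) by rewrite fine_ge0.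
pose r := NngNum p_ge0.
suff -> : P (E `&` X i @^-1` A) = mscale r P E.
  by rewrite /mscale/= fineK ?fin_num_measure// muleC.
rewrite -[LHS]/(mrestr P mXA E).
apply: (g_sigma_algebra_measure_unique (cylinders X S) _ (fun=> setT)) => //.
- exact: measurable_cylinders.
- move=> _; exists fset0, (fun=> setT); split => //.
  by rewrite set_fset0 bigcap_set0.
- by rewrite bigcup_const.
- exact: setI_closed_cylinders.
- move=> _ [J [C [JS mC ->]]].
  have iJ : i \notin J by apply/negP => /JS.
  have JD : [set` J] `<=` D by exact: subset_trans JS SD.
  (* Putting [A] at the new index [i] makes the intersection a single cylinder over [J] and [i], to
     which mutual independence applies. *)
  pose C' j := if j == i then A else C j.
  have C'E : {in J, C' =1 C}.
    by move=> j jJ; rewrite /C'; case: eqP => // ji; rewrite -ji jJ in iJ.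
  have C'i : C' i = A by rewrite /C' eqxx.
  have := indep (i |` J)%fset C'; rewrite big_fsetU1//= C'i.
  rewrite /mrestr/mscale/= fineK ?fin_num_measure// (indep J C)// => indepE.
  rewrite (eq_big_seq (fun j => P (X j @^-1` C' j))); last first.
    by move=> j jJ; rewrite C'E.
  rewrite -indepE.
  + congr (P _); apply/seteqP; split=> [w [wC wA] j /=|w wC].
      rewrite in_fset1U => /orP[/eqP ->|jJ]; first by rewrite C'i.
      by rewrite C'E//; exact: wC.
    split=> [j jJ|]; last by have := wC i; rewrite /= fset1U1 C'i; apply.
    by have := wC j; rewrite /= C'E// => /(_ _); apply; rewrite in_fset1U jJ orbT.
  + by move=> j /=; rewrite in_fset1U => /orP[/eqP ->|/JD].
  + by move=> j _; rewrite /C'; case: ifP.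
- by move=> _; rewrite /= /mrestr setTI (le_lt_trans (probability_le1 _ _)) ?ltry.
Qed.
End independence.

Lemma measurable_fun_mem {disp} {T : measurableType disp} (A : set T) :
  measurable A -> measurable_fun [set: T] (fun w => nat_of_bool (w \in A)).
Proof.
move=> mA _ Y _; rewrite setTI.
have -> : (fun w => nat_of_bool (w \in A)) @^-1` Y =
    (A `&` [set _ | Y 1%N]) `|` (~` A `&` [set _ | Y 0%N]).
  apply/seteqP; split=> w /=; case: (boolP (w \in A)) => /=;
    rewrite ?(inE, notin_setE); tauto.
have mcst b : measurable [set _ : T | Y b].
  have [Yb|nYb] := pselect (Y b).
    by rewrite (_ : mkset _ = setT)//; apply/seteqP; split.
  by rewrite (_ : mkset _ = set0)//; apply/seteqP; split.
by apply: measurableU; apply: measurableI => //; exact: measurableC.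
Qed.

(** More indices generate a larger sigma-algebra. This serves to pass from the candidates after
    stage [k] to those after an earlier index [j < k]. *)
Lemma measurable_fun_cylindersS {disp disp' : measure_display}
    {Omega : measurableType disp} {T : measurableType disp'} {R : realType}
    {P : probability Omega R} {I : choiceType} (X : I -> {RV P >-> T})
    (S S' : set I) : S `<=` S' ->
  forall (f : Omega -> nat),
  measurable_fun [set: g_sigma_algebraType (cylinders X S)] f ->
  measurable_fun [set: g_sigma_algebraType (cylinders X S')] f.
Proof.
move=> SS' f mf _ Y mY.
have {mf} := mf measurableT Y mY; apply: smallest_sub.
  exact: smallest_sigma_algebra.
move=> _ [J [A [JS mA ->]]]; apply: sub_gen_smallest; exists J, A.
by split=> //; exact: subset_trans SS'.
Qed.

(** * Expectations of variables with values in [nat] *)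

Section expectation_nat.
Context {disp : measure_display} {Omega : measurableType disp} {R : realType}
  (P : probability Omega R).
Local Open Scope ereal_scope.

Lemma measurable_natr (f : Omega -> nat) : measurable_fun [set: Omega] f ->
  measurable_fun [set: Omega] (fun w => ((f w)%:R : R)%:E).
Proof.
move=> mf; apply/measurable_EFinP.
by apply: (@measurableT_comp _ _ _ _ _ _ (fun n : nat => n%:R : R)).
Qed.

(** The values are nonnegative, so additivity of the integral follows from measurability alone. *)
Lemma expectation_addn (f g : Omega -> nat) :
  measurable_fun [set: Omega] f -> measurable_fun [set: Omega] g ->
  'E_P[fun w => (f w + g w)%N%:R] =
    'E_P[fun w => (f w)%:R] + 'E_P[fun w => (g w)%:R].
Proof.
move=> mf mg; rewrite !expectation.unlock -ge0_integralD//.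
- by apply: eq_integral => w _; rewrite natrD EFinD.
- exact: measurable_natr.
- exact: measurable_natr.
Qed.

Lemma expectation_sumn {I : eqType} (r : seq I) (f : I -> Omega -> nat) :
  (forall i, i \in r -> measurable_fun [set: Omega] (f i)) ->
  'E_P[fun w => (\sum_(i <- r) f i w)%N%:R] =
    \sum_(i <- r) 'E_P[fun w => (f i w)%:R].
Proof.
elim: r => [|i r IH] mf.
  rewrite big_nil -[RHS](expectation_cst P) /cst; congr expectation.
  by apply/funext => w; rewrite big_nil.
have mfr j : j \in r -> measurable_fun [set: Omega] (f j).
  by move=> jr; apply: mf; rewrite in_cons jr orbT.
rewrite big_cons -IH// -expectation_addn.
- by congr expectation; apply/funext => w; rewrite big_cons.
- exact/mf/mem_head.
- exact: measurable_fun_sumn.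
Qed.

Lemma expectation_mem (A : set Omega) : measurable A ->
  'E_P[fun w => (w \in A)%:R] = P A.
Proof. exact: expectation_indic. Qed.

End expectation_nat.

(** * Pointwise counting identities *)

Section num_new.
Context {T : Type} (B : nat -> set T) (N m : nat) (u : nat -> nat -> T).

Lemma num_new_le j : (num_new B N m u j <= N)%N.
Proof. by rewrite num_newE leq_subr. Qed.

(** Layer-cake form: a sum of indicators over a range that does not depend on the outcome, ready for
    linearity of expectation. *)
Lemma num_new_sum_leq j :
  num_new B N m u j = (\sum_(1 <= l < N.+1) (l <= num_new B N m u j))%N.
Proof.
have := num_new_le j; set n := num_new _ _ _ _ _ => nN.
rewrite (big_cat_nat (n := n.+1))//= (eq_big_nat _ _ (F2 := fun=> 1%N)); last first.
  by move=> l /andP[_]; rewrite ltnS => ->.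
rewrite sum_nat_const_nat subSS subn0 muln1 big_nat big1 ?addn0// => l.
by case/andP; rewrite ltnNge => /negbTE ->.
Qed.

(** The outcome-dependent upper limit of the inner sum is traded for the fixed [N] and an indicator.
    Each term is then a product of the two indicators that will be shown independent. *)
Lemma num_reusedE j : num_reused B N m u j =
  (\sum_(j.+1 <= k < m.+1) \sum_(1 <= l < N.+1)
     (l <= num_new B N m u k) * (u k l \in B j))%N.
Proof.
apply: eq_bigr => k _; have := num_new_le k; set n := num_new _ _ _ _ _ => nN.
rewrite [RHS](big_cat_nat (n := n.+1))//= [X in _ = (_ + X)%N]big_nat.
rewrite [X in _ = (_ + X)%N]big1 ?addn0; last first.
  by move=> l /andP[]; rewrite ltnNge => /negbTE ->.
by apply: eq_big_nat => l /andP[_]; rewrite ltnS => ->; rewrite mul1n.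
Qed.

Lemma num_newD_reused j :
  (forall i, (0 < i < m)%N -> B i `<=` B i.+1) -> (0 < j <= m)%N ->
  (num_new B N m u j + num_reused B N m u j = N)%N.
Proof. by move=> Bn jm; rewrite num_newE subnK// num_reused_le. Qed.

End num_new.

(** * The logarithmic estimate for real sequences *)

(** Termwise [1 - 1/x <= ln x] at the successive ratios, with telescoping logarithms. The equality
    case is recorded because strictness of the final bound is derived from it. *)
Lemma sum_ratio_le_ln {R : realType} (v : nat -> R) (m : nat) : (1 <= m)%N ->
  (forall i, (1 <= i <= m)%N -> 0 < v i) ->
  (forall i, (1 <= i < m)%N -> v i <= v i.+1) ->
  \sum_(1 <= i < m) (1 - v i / v i.+1) <= ln (v m / v 1%N) ?= iff (v m == v 1%N).
Proof.
elim: m => // -[_ _ v0 _|m IH _ v0 vS].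
  by rewrite big_geq// divff ?lt0r_neq0 ?v0// ln1 eqxx; split; rewrite ?lexx ?eqxx.
have {IH} IH : \sum_(1 <= i < m.+1) (1 - v i / v i.+1) <= ln (v m.+1 / v 1%N)
    ?= iff (v m.+1 == v 1%N).
  by apply: IH => // i /andP[i1 im]; [apply: v0|apply: vS]; rewrite i1 leqW.
have a0 := v0 1%N isT; have b0 : 0 < v m.+1 by apply: v0; rewrite ltnS leqnSn.
have c0 : 0 < v m.+2 by apply: v0; rewrite ltnS leqnn.
have bc : v m.+1 <= v m.+2 by apply: vS; rewrite ltnSn.
(* Read off the induction hypothesis: the sum has nonnegative terms, hence so is the logarithm above
   it. *)
have ab : v 1%N <= v m.+1.
  have : 0 <= ln (v m.+1 / v 1%N).
    rewrite (le_trans _ IH.1)// big_nat sumr_ge0// => i /andP[i1 im].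
    rewrite subr_ge0 ler_pdivrMr ?mul1r; first by rewrite vS// i1 ltnW.
    by rewrite v0//= leqW.
  by rewrite ln_div ?posrE// subr_ge0 ler_ln.
rewrite big_nat_recr//=.
have -> : v m.+2 / v 1%N = v m.+1 / v 1%N * (v m.+2 / v m.+1).
  by field; rewrite !gt_eqF.
rewrite lnM ?posrE ?divr_gt0//.
have lnbc : 1 - v m.+1 / v m.+2 <= ln (v m.+2 / v m.+1) ?= iff (v m.+2 == v m.+1).
  have [->|cb] := eqVneq (v m.+2) (v m.+1).
    by rewrite divff ?lt0r_neq0// ln1 subrr; split; rewrite ?lexx ?eqxx.
  suff lt : 1 - v m.+1 / v m.+2 < ln (v m.+2 / v m.+1).
    by split; [exact: ltW|exact: lt_eqF].
  have cb1 : v m.+2 / v m.+1 != 1.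
    apply: contra cb => /eqP cb1.
    by rewrite -(divfK (lt0r_neq0 b0) (v m.+2)) cb1 mul1r.
  (* The strict inequality [1 + x < expR x] for nonzero [x], taken at minus the logarithm of the
     ratio. *)
  have : - ln (v m.+2 / v m.+1) != 0 by rewrite oppr_eq0 ln_eq0 ?divr_gt0.
  move=> /expR_gt1Dx; rewrite expRN lnK ?posrE ?divr_gt0// invf_div.
  lra.
(* Since [v m.+1] lies between the two ends, equal ends force both equalities; this is the equality
   case of a sum of two [leif] bounds. *)
have -> : (v m.+2 == v 1%N) = (v m.+1 == v 1%N) && (v m.+2 == v m.+1).
  apply/eqP/andP => [ca|[/eqP <- /eqP//]].
  by split; rewrite eq_le; apply/andP; split; lra.
exact: leifD.
Qed.

(** The deterministic half of the argument: [r] stands for the expected numbers of new samples and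
    [v] for the volumes. *)
Lemma sum_reuse_le_ln {R : realType} (v r : nat -> R) (N m : nat) (Vmin Vmax : R) :
  (1 <= N)%N -> (1 <= m)%N -> 0 < Vmin -> Vmin <= v 1%N -> v m <= Vmax ->
  (forall i, (1 <= i <= m)%N -> 0 < v i) ->
  (forall i, (1 <= i < m)%N -> v i <= v i.+1) ->
  (forall j, (1 <= j <= m)%N ->
    N%:R = r j + \sum_(j.+1 <= k < m.+1) r k * (v j / v k)) ->
  \sum_(1 <= j < m.+1) r j <= (1 + ln (Vmax / Vmin)) * N%:R
  /\ (Vmin < Vmax -> \sum_(1 <= j < m.+1) r j < (1 + ln (Vmax / Vmin)) * N%:R).
Proof.
move=> N1 m1 Vmin0 Vv1 vmV v0 vS rec.
have Nv j : (1 <= j <= m)%N -> N%:R / v j = \sum_(j <= k < m.+1) r k / v k.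
  move=> jm; rewrite (rec j jm) [RHS]big_ltn ?ltnS; last by case/andP: jm.
  rewrite mulrDl mulr_suml; congr (_ + _); apply: eq_big_nat => k /andP[jk km].
  have vj : v j != 0 by rewrite lt0r_neq0// v0.
  have vk : v k != 0.
    by rewrite lt0r_neq0// v0// (leq_trans _ jk).
  by field; rewrite vj vk.
(* By [Nv], the tail sums from [j] and from [j.+1] differ by [r j / v j]. *)
have rE j : (1 <= j < m)%N -> r j = N%:R * (1 - v j / v j.+1).
  move=> /andP[j1 jm].
  have vj : 0 < v j by rewrite v0// j1 ltnW.
  have vj1 : 0 < v j.+1 by rewrite v0// jm.
  have := Nv j; rewrite j1 ltnW// => /(_ isT); rewrite big_ltn ?ltnS ?(ltnW jm)//.
  rewrite -Nv ?jm// => rj.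
  have -> : r j = (N%:R / v j - N%:R / v j.+1) * v j.
    by rewrite rj addrK divfK ?gt_eqF.
  by field; rewrite !gt_eqF.
have rm : r m = N%:R by rewrite (rec m) ?m1/= // big_geq// addr0.
have -> : \sum_(1 <= j < m.+1) r j =
    (1 + \sum_(1 <= j < m) (1 - v j / v j.+1)) * N%:R.
  rewrite big_nat_recr//= rm mulrDl mul1r addrC; congr (_ + _).
  by rewrite mulr_suml; apply: eq_big_nat => j jm; rewrite rE// mulrC.
have N0 : 0 < N%:R :> R by rewrite ltr0n.
have [Sle Seq] := sum_ratio_le_ln v m m1 v0 vS.
have v10 : 0 < v 1%N by exact: lt_le_trans Vv1.
have vm0 : 0 < v m by rewrite v0 ?m1/=.
have Vmax0 : 0 < Vmax by exact: lt_le_trans vmV.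
have lnV : ln (v m / v 1%N) <= ln (Vmax / Vmin).
  rewrite ler_ln ?posrE ?divr_gt0//.
  by apply: ler_pM; rewrite ?invr_ge0 ?lef_pV2 ?posrE// ltW.
split; first by rewrite ler_pM2r// lerD2l (le_trans Sle).
move=> VV; rewrite ltr_pM2r// ltrD2l.
(* Strictness has two sources: distinct extreme volumes make the estimate of the sum strict, while
   equal ones make the sum zero, below the positive [ln (Vmax / Vmin)]. *)
move: Seq; have [vm1|_] := eqVneq (v m) (v 1%N); last first.
  by move=> /negbT SN; rewrite (lt_le_trans _ lnV)// lt_neqAle SN.
rewrite vm1 divff ?lt0r_neq0// ln1 => /eqP ->.
by rewrite ln_gt0// ltr_pdivlMr// mul1r.
Qed.

(** * Expected numbers of new and reused samples *)

Section sample_reuse.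
Context {R : realType} {d : nat} {disp : measure_display}
  {Omega : measurableType disp} (P : probability Omega R) (N m : nat)
  (B : nat -> set (euclid R d)) (U : nat -> nat -> {RV P >-> euclid R d}).
Hypothesis hBmeas : forall i, (1 <= i <= m)%N -> measurable (B i).
Hypothesis hBnested : forall i, (1 <= i < m)%N -> B i `<=` B i.+1.

Let X (jl : nat * nat) := U jl.1 jl.2.
Let n (j : nat) (w : Omega) := num_new B N m (fun j l => U j l w) j.

(* The candidate samples on which [num_new] at stage [j] may depend. *)
Definition later (j : nat) : set (nat * nat) :=
  [set jl | (j < jl.1 <= m)%N /\ (1 <= jl.2 <= N)%N].

(** Descending induction on the stage: [n j] is computed from the [n k] with [k > j] and from
    whether candidates of those stages fall in [B j]. *)
Lemma measurable_num_new_later j : (1 <= j <= m)%N ->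
  measurable_fun [set: g_sigma_algebraType (cylinders X (later j))] (n j).
Proof.
have [r] := ubnP (m - j); elim: r j => // r IH j rE /andP[j1 jm].
have -> : n j = fun w => (N - \sum_(j.+1 <= k < m.+1) \sum_(1 <= l < N.+1)
     (l <= n k w) * (U k l w \in B j))%N.
  by apply/funext => w; rewrite /n num_newE num_reusedE.
apply: (measurable_fun_nat2 subn); first exact: measurable_cst.
apply: measurable_fun_sumn => k; rewrite mem_index_iota ltnS => /andP[jk km].
apply: measurable_fun_sumn => l; rewrite mem_index_iota ltnS => lN.
apply: (measurable_fun_nat2 (fun a b => (l <= a) * b)%N).
  apply: (@measurable_fun_cylindersS _ _ _ _ _ _ _ _ (later k)).
    by move=> [i i'] [/= /andP[ki im] ?]; split=> //=; rewrite (ltn_trans jk ki).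
  apply: IH; last by rewrite km (leq_trans _ jk).
  by rewrite ltnS in rE; rewrite (leq_trans _ rE)// ltn_sub2l// (leq_trans jk).
apply: (@measurable_fun_mem _ (g_sigma_algebraType (cylinders X (later j)))
  (U k l @^-1` B j)).
(* The event that candidate [(k, l)] falls in [B j] is a cylinder with a single constraint. *)
apply: sub_gen_smallest; exists [fset (k, l)]%fset, (fun=> B j); split.
- by move=> i /=; rewrite inE => /eqP ->; split=> //=; rewrite km andbT.
- by move=> _; apply: hBmeas; rewrite j1.
- apply/seteqP; split=> [w Bw i /=|w]; first by rewrite inE => /eqP ->.
  by move=> /(_ (k, l)); apply; rewrite /= inE.
Qed.

Lemma measurable_num_new j : (1 <= j <= m)%N -> measurable_fun [set: Omega] (n j).
Proof.
move=> /measurable_num_new_later mn _ Y mY.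
have := mn measurableT Y mY; apply: smallest_sub.
  exact: sigma_algebra_measurable.
exact: measurable_cylinders.
Qed.

Hypothesis hUunif : forall j l, (1 <= j <= m)%N -> (1 <= l <= N)%N ->
  uniform_on (B j) (U j l).
Hypothesis hUindep : mutually_independent
      [set jl : nat * nat | (1 <= jl.1 <= m)%N /\ (1 <= jl.2 <= N)%N]
      (fun jl => U jl.1 jl.2).

(** A Wald-type identity: for each [l], the event [l <= n k] is independent of candidate [(k, l)],
    so every term factors with the same ratio, and the probabilities of [l <= n k] add up to the
    expectation of [n k]. *)
Lemma expectation_reuse j k : (1 <= j)%N -> (j < k <= m)%N ->
  ('E_P[fun w => (\sum_(1 <= l < N.+1) (l <= n k w) * (U k l w \in B j))%N%:R]
   = 'E_P[fun w => (n k w)%:R] * (vol (B j `&` B k) / vol (B k)))%E.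
Proof.
move=> j1 /andP[jk km].
have jm : (1 <= j <= m)%N by rewrite j1 (leq_trans (ltnW jk)).
have k1m : (1 <= k <= m)%N by rewrite km (leq_trans j1 (ltnW jk)).
have mle l : measurable [set w | (l <= n k w)%N].
  rewrite -[X in measurable X]setTI.
  exact: (measurable_num_new k k1m _ [set a | l <= a]%N).
have mU l : measurable (U k l @^-1` B j).
  by rewrite -[X in measurable X]setTI; apply: measurable_funPT => //; exact: hBmeas.
have -> : (fun w => (n k w)%:R) =
    fun w => (\sum_(1 <= l < N.+1) (w \in [set w | (l <= n k w)%N]))%N%:R :> R.
  apply/funext => w; congr _%:R; rewrite [LHS]num_new_sum_leq.
  by apply: eq_bigr => l _; congr nat_of_bool; apply/idP/idP; rewrite inE.
have -> : (fun w => (\sum_(1 <= l < N.+1) (l <= n k w) * (U k l w \in B j))%N%:R) =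
    fun w => (\sum_(1 <= l < N.+1)
      (w \in [set w | (l <= n k w)%N] `&` U k l @^-1` B j))%N%:R :> R.
  apply/funext => w; congr _%:R; apply: eq_bigr => l _; rewrite in_setI mulnb.
  by congr (nat_of_bool (_ && _)); apply/idP/idP; rewrite !inE.
rewrite !expectation_sumn; last 2 first.
  by move=> l _; exact: measurable_fun_mem.
  by move=> l _; apply: measurable_fun_mem; exact: measurableI.
rewrite ge0_sume_distrl; last by move=> l _; exact: expectation_ge0.
apply: eq_big_seq => l; rewrite mem_index_iota ltnS => lN.
rewrite !expectation_mem//; last exact: measurableI.
rewrite -(hUunif k l) //; last exact: hBmeas.
(* The stages in [later k] are strictly beyond [k], so [(k, l)] is not among them. *)
apply: (@mutually_independent_sigma _ _ _ _ _ _ _ _ X (later k) (k, l))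
  hUindep _ _ _ _ _ => //.
- by move=> [i i'] [/= /andP[ki ->] ->]; split => //; rewrite andbT (leq_trans _ ki).
- by move=> [/=]; rewrite ltnn.
- exact: hBmeas.
- have := measurable_num_new_later k k1m measurableT [set a | l <= a]%N.
  by rewrite setTI; exact.
Qed.

Lemma subset_nested j k : (1 <= j <= k)%N -> (k <= m)%N -> B j `<=` B k.
Proof.
move=> /andP[j1]; elim: k => [|k IH]; first by rewrite leqNgt j1.
rewrite leq_eqVlt => /predU1P[-> _ //|]; rewrite ltnS => jk km.
apply: subset_trans (IH jk (ltnW km)) _.
by apply: hBnested; rewrite (leq_trans j1 jk).
Qed.

(** The expectation of the pointwise identity [num_newD_reused]. It stays in the extended reals, as
    finiteness of the terms is settled only afterwards. *)
Lemma expectation_num_new_rec j : (1 <= j <= m)%N ->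
  (N%:R%:E = 'E_P[fun w => (n j w)%:R] + \sum_(j.+1 <= k < m.+1)
    'E_P[fun w => (n k w)%:R] * (vol (B j) / vol (B k)))%E.
Proof.
move=> jm; have /andP[j1 _] := jm.
rewrite -[LHS](expectation_cst P).
have mreuse k l : (j < k <= m)%N ->
    measurable_fun [set: Omega] (fun w => (l <= n k w) * (U k l w \in B j))%N.
  move=> /andP[jk km].
  apply: (measurable_fun_nat2 (fun a b => (l <= a) * b)%N).
    by apply: measurable_num_new; rewrite km (leq_trans j1 (ltnW jk)).
  apply: (measurable_fun_mem (U k l @^-1` B j)).
  by rewrite -[X in measurable X]setTI; apply: measurable_funPT => //; exact: hBmeas.
have -> : cst N%:R = fun w => (n j w + \sum_(j.+1 <= k < m.+1)
    \sum_(1 <= l < N.+1) (l <= n k w) * (U k l w \in B j))%N%:R :> R.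
  apply/funext => w; congr _%:R; rewrite -num_reusedE num_newD_reused//.
rewrite expectation_addn; first last.
- apply: measurable_fun_sumn => k; rewrite mem_index_iota ltnS => jkm.
  by apply: measurable_fun_sumn => l _; exact: mreuse.
- exact: measurable_num_new.
congr (_ + _)%E; rewrite expectation_sumn; last first.
  move=> k; rewrite mem_index_iota ltnS => jkm.
  by apply: measurable_fun_sumn => l _; exact: mreuse.
apply: eq_big_seq => k; rewrite mem_index_iota ltnS => jkm.
have /andP[jk km] := jkm.
have sub : B j `<=` B k by apply: subset_nested => //; rewrite j1 ltnW.
by rewrite (expectation_reuse j k j1 jkm) (setIidl sub).
Qed.

End sample_reuse.

(** Strictness is claimed for [Vmin < Vmax]: when they coincide, all volumes agree, only stage [m]
    draws new samples, and the expected total is exactly [N], which is then the bound. *)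
Theorem theorem1 (R : realType) (d : nat)
    (disp : measure_display) (Omega : measurableType disp)
    (P : probability Omega R)
    (Vmin Vmax : R) (hVmin : 0 < Vmin) (hV : Vmin <= Vmax)
    (N m : nat) (hN : (1 <= N)%N) (hm : (1 <= m)%N)
    (B : nat -> set (euclid R d))
    (hBmeas : forall i, (1 <= i <= m)%N -> measurable (B i))
    (hBnested : forall i, (1 <= i < m)%N -> B i `<=` B i.+1)
    (hB1 : (Vmin%:E <= vol (B 1%N))%E) (hBm : (vol (B m) <= Vmax%:E)%E)
    (U : nat -> nat -> {RV P >-> euclid R d})
    (hUunif : forall j l, (1 <= j <= m)%N -> (1 <= l <= N)%N ->
      uniform_on (B j) (U j l))
    (hUindep : mutually_independent
      [set jl : nat * nat | (1 <= jl.1 <= m)%N /\ (1 <= jl.2 <= N)%N]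
      (fun jl => U jl.1 jl.2)) :
  let n := fun w : Omega => num_total B N m (fun j l => U j l w) in
  let bound := ((1 + ln (Vmax / Vmin)) * N%:R)%:E in
  ('E_P[fun w => (n w)%:R] <= bound)%E /\
  (Vmin < Vmax -> ('E_P[fun w => (n w)%:R] < bound)%E).
Proof.
move=> n bound.
pose e k : \bar R :=
  'E_P[fun w => (num_new B N m (fun j l => U j l w) k)%:R]%E.
(* [fine] sends infinite values to 0, so [v k] is known to be the volume only for [k] from 1 to [m],
   where [B k] lies inside [B m]. *)
pose v k := fine (vol (B k)).
have nested := subset_nested m B hBnested.
have volE k : (1 <= k <= m)%N -> vol (B k) = (v k)%:E.
  move=> /andP[k1 km]; rewrite fineK// ge0_fin_numE ?lebesgue_outer_ge0//.
  apply: le_lt_trans (ltry Vmax); apply: le_trans hBm.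
  by apply: le_lebesgue_outer; apply: nested; rewrite ?k1.
have v0 k : (1 <= k <= m)%N -> 0 < v k.
  move=> km; rewrite -lte_fin -volE// (lt_le_trans _ (le_trans hB1 _)) ?lte_fin//.
  by apply: le_lebesgue_outer; case/andP: km => k1 km; apply: nested; rewrite ?k1.
have ratioE j k : (1 <= j <= m)%N -> (1 <= k <= m)%N ->
    (vol (B j) / vol (B k))%E = (v j / v k)%:E.
  by move=> jm km; rewrite !volE// inver (gt_eqF (v0 k km)).
have e_ge0 k : (0 <= e k)%E by exact: expectation_ge0.
have later_le j k : (1 <= j <= m)%N -> (j < k < m.+1)%N -> (1 <= k <= m)%N.
  by move=> /andP[j1 _] /andP[jk km]; rewrite (leq_trans j1 (ltnW jk)).
have rec j : (1 <= j <= m)%N ->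
    (N%:R%:E = e j + \sum_(j.+1 <= k < m.+1) e k * (v j / v k)%:E)%E.
  move=> jm; rewrite (expectation_num_new_rec P N m B U hBmeas hBnested hUunif
    hUindep j jm); congr (_ + _)%E.
  by apply: eq_big_nat => k jkm; rewrite ratioE// (later_le j).
(* Finiteness comes from the recursion itself, which writes [N] as [e k] plus nonnegative terms. *)
have eE k : (1 <= k <= m)%N -> e k = (fine (e k))%:E.
  move=> km; rewrite fineK// ge0_fin_numE// (le_lt_trans _ (ltry N%:R))//.
  rewrite (rec k km) leeDl// big_nat sume_ge0// => i ikm.
  rewrite mule_ge0// lee_fin ltW// divr_gt0// v0//.
  exact: later_le ikm.
have -> : 'E_P[fun w => (n w)%:R]%E = (\sum_(1 <= j < m.+1) fine (e j))%:E.
  rewrite expectation_sumn; last first.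
    by move=> j; rewrite mem_index_iota ltnS; exact: measurable_num_new.
  rewrite -sumEFin; apply: eq_big_seq => j; rewrite mem_index_iota ltnS => jm.
  by rewrite -eE.
rewrite lee_fin lte_fin; apply: (sum_reuse_le_ln v) => //.
- by rewrite -lee_fin -volE.
- by rewrite -lee_fin -volE// hm leqnn.
- move=> i /andP[i1 im]; rewrite -lee_fin -!volE ?i1 ?(ltnW im)//.
  by apply: le_lebesgue_outer; apply: hBnested; rewrite i1.
- move=> j jm; apply: EFin_inj; rewrite EFinD -sumEFin -eE// (rec j jm).
  congr (_ + _)%E; apply: eq_big_nat => k jkm.
  by rewrite [RHS]EFinM -eE// (later_le j).
Qed.
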